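(* Let $Z=(Z_1,\dots,Z_n)$ be a random vector with independent components taking values in a product $\mathcal Z=\prod_{i=1}^n\mathcal Z_i$ of measurable spaces. Let $T>0$, let $g_j\colon\mathcal Z\to[-1,1]$ be measurable and $\psi_j\colon[0,T]\to\mathbb R$ continuously differentiable, $j=1,\dots,m$, with $\sum_{j=1}^m|\psi_j(t)|=1$ for all $t\in[0,T]$. Put $$X_Z(t)=\sum_{j=1}^m g_j(Z)\psi_j(t),\quad t\in[0,T],$$ and assume $\mathbb E[X_Z(t)]=0$ for all $t\in[0,T]$. Let $$\mathrm{Arc}_{\ell_1}:=\int_0^T\sum_{j=1}^m|\psi_j'(s)|\,\mathrm ds .$$ If $1<\eta_X<\infty$, then for all $\varepsilon>0$, $$\mathbb P\left\{\frac{\sqrt{\eta_X}}{\mathcal R\big((2+\mathrm{Arc}_{\ell_1})^2\eta_X\big)}\ \sup_{t\in[0,T]}|X_Z(t)|\ge\varepsilon\right\}\le 2\mathrm e^{-2\varepsilon^2},$$ where $$\mathcal R(x):=\sqrt{\log_4x}+2\min\left\{1,\ \frac{\ln(\mathrm e+\ln x)}{\sqrt{\ln x}}\right\}\quad\text{for all }x>1.$$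
   Context: For the function $X(z,t)=\sum_{j=1}^m g_j(z)\psi_j(t)$ on $\mathcal Z\times[0,T]$, put $c_i(X):=\sup_{t\in[0,T],\,z_i^*\in\mathcal Z_i,\,z\in\mathcal Z}|X(z_i^*,z_{-i},t)-X(z,t)|$, where $(z_i^*,z_{-i})$ is $z$ with its $i$-th coordinate replaced by $z_i^*$, and define the effective sample size $\eta_X:=\left(\sum_{i=1}^n c_i(X)^2\right)^{-1}\in(0,\infty]$ (with $1/0=\infty$). $\ln$ is the natural logarithm and $\log_4x=\ln x/\ln4$. *)

(* Defs.v *)
From HB Require Import structures.
From mathcomp Require Import all_boot all_order all_algebra.
From mathcomp Require Import all_classical all_reals all_analysis.

Set Implicit Arguments.
Unset Strict Implicit.
Unset Printing Implicit Defensive.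

Import Order.TTheory GRing.Theory Num.Theory.
Import numFieldNormedType.Exports.

Local Open Scope classical_set_scope.
Local Open Scope ring_scope.

Definition coordinate_sets n (d : 'I_n -> measure_display)
    (S : forall i, measurableType (d i)) : set (set (forall i, S i)) :=
  [set C | exists i (A : set (S i)), measurable A /\ C = [set z | A (z i)]].
Arguments coordinate_sets {n d} S.

Definition product_space n (d : 'I_n -> measure_display)
    (S : forall i, measurableType (d i)) :=
  g_sigma_algebraType (coordinate_sets S).

Definition independent_components d0 (Omega : measurableType d0)
    (R : realType) (P : probability Omega R) n (d : 'I_n -> measure_display)
    (S : forall i, measurableType (d i)) (Z : Omega -> product_space S) : Prop :=
  forall (J : {set 'I_n}) (A : forall i, set (S i)),
    (forall i, measurable (A i)) ->
    P [set w | forall i, i \in J -> A i (Z w i)] =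
    (\prod_(i in J) P [set w | A i (Z w i)])%E.

Section calculus.
Context {R : realType}.

(* Derivatives relative to A: difference quotients only see the values of f on
   A, so that they are one-sided at the endpoints when A is an interval. *)
Definition derivable_on (A : set R) (f : R -> R) (x : R) : Prop :=
  cvg ((f y - f x) / (y - x) @[y --> within A x^']).

Definition derive_on (A : set R) (f : R -> R) (x : R) : R :=
  lim ((f y - f x) / (y - x) @[y --> within A x^']).

Definition C1_on (A : set R) (f : R -> R) : Prop :=
  (forall x, A x -> derivable_on A f x) /\
  {within A, continuous (derive_on A f)}.

Definition arc_l1 m (T : R) (psi : 'I_m -> R -> R) : R :=
  \int[lebesgue_measure]_(s in `[0, T])
    (\sum_(j < m) `|derive_on `[0, T] (psi j) s|).

Definition log4 (x : R) : R := ln x / ln 4.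

Definition calR (x : R) : R :=
  Num.sqrt (log4 x) + 2 * Num.min 1 (ln (expR 1 + ln x) / Num.sqrt (ln x)).

End calculus.

Section effective_sample_size.
Context {R : realType} {n : nat} {d : 'I_n -> measure_display}
  {S : forall i, measurableType (d i)}.
Implicit Types (T : R) (X : product_space S -> R -> R).

Definition linear_process m (g : 'I_m -> product_space S -> R)
    (psi : 'I_m -> R -> R) : product_space S -> R -> R :=
  fun z t => \sum_(j < m) g j z * psi j t.

Definition replace_coord (z : product_space S) (i : 'I_n) (zi : S i) :
  product_space S := dfwith z i zi.

(* Extended-real supremum: no boundedness of X is presupposed. *)
Definition influence T X (i : 'I_n) : \bar R :=
  ereal_sup [set r | exists t (zi : S i) (z : product_space S),
    t \in `[0, T] /\ r = `|X (replace_coord z zi) t - X z t|%:E].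

(* On extended reals 0^-1 = +oo. *)
Definition effective_sample_size T X : \bar R :=
  ((\sum_(i < n) influence T X i ^+ 2)^-1)%E.

End effective_sample_size.

(* Main.v *)
(** For fixed [t], McDiarmid's inequality gives
    [P (|X_Z(t)| >= u) <= 2 exp (- 2 u^2 eta)]. It is proved by averaging out
    one coordinate at a time: replacing [Z_i] by an independent copy does not
    change the law of [Z], and Hoeffding's lemma bounds the conditional
    exponential moment. Along the arc-length parametrization, [N] equally spaced
    times form a net on which [X_Z] determines its supremum up to [Arc / (2 N)],
    so that a union bound leaves
    [2 N exp (- 2 eta (u - Arc / (2 N))^2)].
    With [L = ln ((2 + Arc)^2 eta)], choosing [N] close to
    [Arc sqrt eta / s] for [s = 2] or [s = 2 / sqrt L], according to which term
    attains the minimum in [calR], makes this at most [2 exp (- 2 eps^2)] once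
    [2 exp (- 2 eps^2) <= 1]; otherwise there is nothing to prove. *)

Require Import Defs.
From mathcomp Require Import all_boot all_order all_algebra.
From mathcomp Require Import all_classical all_reals all_analysis.
From mathcomp Require Import measurable_realfun ring lra.

Set Implicit Arguments.
Unset Strict Implicit.

Import Order.TTheory GRing.Theory Num.Theory.
Import numFieldNormedType.Exports.

Local Open Scope classical_set_scope.
Local Open Scope ring_scope.

(** * Hoeffding's lemma *)

(** Applied twice in a row below: from the sign of a second derivative to that of the first, then to
    that of the function. *)
Lemma ge0_derive_nonneg (R : realType) (f df : R -> R) :
  (forall x : R, 0 <= x -> is_derive x 1 f (df x)) ->
  (forall x : R, 0 <= x -> 0 <= df x) -> f 0 = 0 ->
  forall x : R, 0 <= x -> 0 <= f x.
Proof.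
move=> fd df0 f00 x x0; rewrite -f00.
apply: (@ger0_derive1_ndecry _ f 0) => // [y|y|].
- by rewrite in_itv/= andbT => /ltW y0; have := fd y y0 => ?; exact: ex_derive.
- rewrite in_itv/= andbT => /ltW y0; have := fd y y0 => ?.
  by rewrite derive1E derive_val; exact: df0.
- apply: derivable_within_continuous => y; rewrite in_itv/= andbT => y0.
  by have := fd y y0 => ?; exact: ex_derive.
Qed.

(** * The moment generating function of a Bernoulli variable *)

Section bernoulli_mgf.
Context {R : realType} (p : R) (p01 : 0 <= p <= 1).
Let D (h : R) : R := 1 - p + p * expR h.

Let D_gt0 (h : R) : 0 < D h.
Proof.
rewrite /D; have := expR_gt0 h; case/andP: p01 => p0 p1 e0.
have [->|pn] := eqVneq p 1; first by rewrite subrr add0r mul1r.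
rewrite ltr_pwDl ?mulr_ge0 ?(ltW e0)//.
by rewrite subr_gt0 lt_neqAle pn.
Qed.

Let dD (h : R) : is_derive h 1 D (p * expR h).
Proof. rewrite /D; apply: is_derive_eq. by rewrite add0r mul1r. Qed.

(** The difference [F] of the logarithms vanishes at 0 together with its derivative [G], and its
    second derivative is [1/4 - q (1 - q) >= 0] with [q = p e^h / D h]. *)
Lemma bernoulli_mgf_ge0 (h : R) : 0 <= h ->
  1 - p + p * expR h <= expR (p * h + h ^+ 2 / 8).
Proof.
move=> h0; rewrite -[leLHS]lnK ?posrE ?D_gt0// ler_expR -subr_ge0.
pose G (x : R) : R := p + x / 4 - p * expR x / D x.
have G0 (x : R) : 0 <= x -> 0 <= G x.
  apply: (@ge0_derive_nonneg _ _
    (fun x => 1 / 4 - (p * expR x * D x - p * expR x * (p * expR x)) / D x ^+ 2)).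
  - move=> y y0; have Dy := lt0r_neq0 (D_gt0 y).
    have dV := is_deriveV Dy (dD y).
    apply: is_derive_eq.
    by rewrite /GRing.scale/=; field.
  - move=> y y0; have := D_gt0 y; move: (expR_gt0 y).
    rewrite /D; set e := expR y => e0 De.
    rewrite subr_ge0 ler_pdivrMr ?exprn_gt0// -subr_ge0.
    (* With denominators cleared, [1/4 - q (1 - q)] is a perfect square. *)
    have -> : 1 / 4 * (1 - p + p * e) ^+ 2 -
      (p * e * (1 - p + p * e) - p * e * (p * e)) =
      (1 - p - p * e) ^+ 2 / 4 by field.
    by rewrite divr_ge0 ?sqr_ge0.
  - by rewrite /G /D expR0; field; rewrite ?mulr1 ?subrK ?oner_neq0.
pose F (x : R) : R := p * x + x ^+ 2 / 8 - ln (D x).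
suff : 0 <= F h by [].
apply: (@ge0_derive_nonneg _ F G _ G0 _ h h0).
- move=> y y0; have dl := is_derive1_ln (D_gt0 y).
  have dlD := is_derive1_comp dl (dD y).
  apply: is_derive_eq.
  by rewrite /GRing.scale/= /G; field; rewrite lt0r_neq0.
- by rewrite /F /D expR0 mulr1 subrK ln1 mulr0 expr0n/= mul0r addr0 subr0.
Qed.

End bernoulli_mgf.

(** For [h < 0], exchanging the two outcomes turns [(p, h)] into [(1 - p, - h)] at the cost of a
    factor [e^h]. *)
Lemma bernoulli_mgf (R : realType) (p h : R) : 0 <= p <= 1 ->
  1 - p + p * expR h <= expR (p * h + h ^+ 2 / 8).
Proof.
move=> p01; have [h0|h0] := leP 0 h; first exact: bernoulli_mgf_ge0.
have q01 : 0 <= 1 - p <= 1 by lra.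
have := @bernoulli_mgf_ge0 _ (1 - p) q01 (- h); rewrite oppr_ge0 => /(_ (ltW h0)).
rewrite -(ler_pM2r (expR_gt0 h)) -expRD.
have -> : (1 - p) * - h + (- h) ^+ 2 / 8 + h = p * h + h ^+ 2 / 8 by field.
apply: le_trans; rewrite mulrDl -mulrA -expRD addNr expR0; lra.
Qed.

Lemma expR_convex (R : realType) (t x y : R) : 0 <= t <= 1 ->
  expR ((1 - t) * x + t * y) <= (1 - t) * expR x + t * expR y.
Proof.
move=> /andP[t0 t1]; set m := (1 - t) * x + t * y.
(* The exponential lies above its tangent at [m]; averaging this at [x] and [y] cancels the linear
   terms. *)
have tangent z : expR m * (1 + (z - m)) <= expR z.
  have -> : expR z = expR m * expR (z - m) by rewrite -expRD subrKC.
  by rewrite ler_pM2l ?expR_gt0// expR_ge1Dx.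
have -> : expR m = (1 - t) * (expR m * (1 + (x - m))) + t * (expR m * (1 + (y - m))).
  by rewrite /m; ring.
by rewrite lerD// ler_wpM2l// subr_ge0.
Qed.

Section hoeffding.
Context d (T : measurableType d) (R : realType) (P : probability T R).

Lemma bounded_integrable (f : T -> R) (M : R) :
  measurable_fun setT f -> (forall x, `|f x| <= M) ->
  P.-integrable setT (EFin \o f).
Proof.
move=> mf fM; apply: measurable_bounded_integrable => //.
  by rewrite (le_lt_trans (probability_le1 P measurableT))// ltry.
exists M; split; first exact: num_real.
by move=> N MN x _; apply: le_trans (fM x) (ltW MN).
Qed.

Lemma probability_nonempty : exists x : T, True.
Proof.
apply: contrapT => T0; have := probability_setT P.
have -> : [set: T] = set0 by apply/seteqP; split => // x _; apply: T0; exists x.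
by rewrite measure0 => /eqP; rewrite lt_eqF ?lte01.
Qed.

Lemma Rintegral_probability_cst (k : R) : \int[P]_x k = k.
Proof. by rewrite Rintegral_cst//= probability_setT mulr1. Qed.

(** By convexity [expR (h * f)] lies below the chord of the exponential over an interval of length
    [c] containing the range of [f]. The chord integrates to a Bernoulli moment generating
    function. *)
Lemma hoeffding_lemma (f : T -> R) (c M h : R) :
  measurable_fun setT f -> (forall x, `|f x| <= M) ->
  (forall x y, f x - f y <= c) ->
  \int[P]_x expR (h * f x) <= expR (h * \int[P]_x f x + h ^+ 2 * c ^+ 2 / 8).
Proof.
move=> mf fM fc; have [x0 _] := probability_nonempty.
have c0 : 0 <= c by have := fc x0 x0; rewrite subrr.
(* Starting at the infimum turns the bound on differences into [a <= f <= a + c]. *)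
pose a := inf (range f).
have lbf : has_lbound (range f).
  by exists (- M) => _ [y _ <-]; have := fM y; rewrite ler_norml => /andP[].
have af x : a <= f x by apply: (ge_inf lbf); exists x.
have fac x : f x <= a + c.
  rewrite -lerBlDr; apply: lb_le_inf; first by exists (f x0), x0.
  by move=> _ [y _ <-]; have := fc x y; lra.
have intf : P.-integrable setT (EFin \o f) by exact: bounded_integrable fM.
(* A constant [f] is treated apart, since the weights below divide by [c]. *)
have [c00|cn0] := eqVneq c 0.
  have -> : f = cst a.
    by apply/funext => y; have := af y; have := fac y; rewrite c00 /cst; lra.
  rewrite /= !Rintegral_probability_cst ler_expR c00; lra.
have {cn0}c0 : 0 < c by rewrite lt0r cn0.
set E := \int[P]_x f x.
pose p := (E - a) / c.
have aE : a <= E.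
  rewrite -[a]Rintegral_probability_cst; apply: le_Rintegral => //.
  by apply: (@bounded_integrable (cst a) `|a|).
have Eac : E <= a + c.
  rewrite -[a + c]Rintegral_probability_cst; apply: le_Rintegral => //.
  by apply: (@bounded_integrable (cst (a + c)) `|a + c|).
have p01 : 0 <= p <= 1.
  by rewrite divr_ge0 ?subr_ge0 ?(ltW c0)//= ler_pdivrMr// mul1r lerBlDl.
(* [A * y + B] is the chord of [y |-> expR (h * y)] over [[a, a + c]]. *)
pose A := expR (h * a) * ((expR (h * c) - 1) / c).
pose B := expR (h * a) - A * a.
apply: (@le_trans _ _ (\int[P]_x (A * f x + B))).
  apply: le_Rintegral => //.
  - apply: (@bounded_integrable _ (expR (`|h| * M))).
      by apply: measurableT_comp => //; exact: measurable_funM.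
    move=> y; rewrite ger0_norm ?expR_ge0// ler_expR.
    by rewrite (le_trans (ler_norm _))// normrM ler_wpM2l.
  - apply: (@bounded_integrable _ (`|A| * M + `|B|)).
      by apply: measurable_funD => //; exact: measurable_funM.
    by move=> y; rewrite (le_trans (ler_normD _ _))// lerD2r normrM ler_wpM2l.
  - move=> y _.
    pose t := (f y - a) / c.
    have fyE : h * f y = (1 - t) * (h * a) + t * (h * a + h * c).
      by rewrite /t; field; rewrite lt0r_neq0.
    have -> : A * f y + B = (1 - t) * expR (h * a) + t * expR (h * a + h * c).
      by rewrite /B /A /t expRD; field; rewrite lt0r_neq0.
    rewrite fyE; apply: expR_convex.
    by rewrite divr_ge0 ?subr_ge0 ?(ltW c0)//= ler_pdivrMr// mul1r lerBlDl.
rewrite RintegralD//; last 2 first.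
  - apply: (@bounded_integrable (fun y => A * f y) (`|A| * M)).
      by exact: measurable_funM.
    by move=> y; rewrite normrM ler_wpM2l.
  - by apply: (@bounded_integrable (cst B) `|B|).
rewrite RintegralZl// Rintegral_probability_cst -/E.
have -> : A * E + B = expR (h * a) * (1 - p + p * expR (h * c)).
  by rewrite /B /A /p; field; rewrite lt0r_neq0.
have -> : h * E + h ^+ 2 * c ^+ 2 / 8 = h * a + (p * (h * c) + (h * c) ^+ 2 / 8).
  by rewrite /p; field; rewrite lt0r_neq0.
by rewrite expRD ler_pM2l ?expR_gt0// bernoulli_mgf.
Qed.

End hoeffding.

(** * Resampling one coordinate *)

Lemma measurable_coordinate n (d : 'I_n -> measure_display)
    (S : forall i, measurableType (d i)) (i : 'I_n) :
  measurable_fun [set: product_space S] (fun z : product_space S => z i).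
Proof.
move=> _ A mA; rewrite setTI; apply: sub_sigma_algebra.
by exists i, A.
Qed.
Arguments measurable_coordinate {n d} S i.

(** * Rectangles and measurability in the product space *)

Section product_space_theory.
Context {n : nat} {d : 'I_n -> measure_display}
  {S : forall i, measurableType (d i)}.

Definition rectangle (A : forall i, set (S i)) : set (product_space S) :=
  [set z | forall i, A i (z i)].

(** Unlike the generating coordinate sets, these are stable under intersection, as uniqueness of
    measures requires. *)
Definition measurable_rectangles : set (set (product_space S)) :=
  [set C | exists2 A, (forall i, measurable (A i)) & C = rectangle A].

Lemma measurable_rectangle (A : forall i, set (S i)) :
  (forall i, measurable (A i)) -> measurable (rectangle A).
Proof.
move=> mA.
have -> : rectangle A =
    \bigcap_(i in [set: 'I_n]) (fun z : product_space S => z i) @^-1` A i.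
  by apply/seteqP; split => [z Az i _|z Az i]; [exact: Az|exact: (Az i I)].
apply: fin_bigcap_measurable => // i _.
by rewrite -[X in measurable X]setTI; exact: measurable_coordinate.
Qed.

Lemma coordinate_sets_rectangle : coordinate_sets S `<=` measurable_rectangles.
Proof.
move=> _ [i [A [mA ->]]]; exists (dfwith (fun j => [set: S j]) i A).
  by move=> j; case: dfwithP.
apply/seteqP; split => [z Az j|z /(_ i)]; last by rewrite dfwithin.
by case: dfwithP.
Qed.

Lemma measurable_rectanglesE :
  @measurable _ (product_space S) = <<s measurable_rectangles >>.
Proof.
apply/seteqP; split.
  apply: sub_smallest2r coordinate_sets_rectangle.
  exact: smallest_sigma_algebra.
apply: smallest_sub; first exact: sigma_algebra_measurable.
by move=> _ [A mA ->]; exact: measurable_rectangle.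
Qed.

Lemma measurable_rectangles_setI : setI_closed measurable_rectangles.
Proof.
move=> _ _ [A mA ->] [B mB ->]; exists (fun i => A i `&` B i).
  by move=> i; exact: measurableI.
by apply/seteqP; split => [z [Az Bz] i|z ABz]; split => // i; have [] := ABz i.
Qed.

Lemma eq_measure_rectangle (R : realType)
    (m1 m2 : {measure set (product_space S) -> \bar R}) :
  (m1 setT < +oo)%E ->
  (forall A, (forall i, measurable (A i)) -> m1 (rectangle A) = m2 (rectangle A)) ->
  forall E, measurable E -> m1 E = m2 E.
Proof.
move=> m1T m12 E mE.
apply: (measure_unique measurable_rectangles (fun=> setT)) => //.
- exact: measurable_rectanglesE.
- exact: measurable_rectangles_setI.
- move=> _; exists (fun i => setT) => //.
  by apply/seteqP; split.
- by rewrite bigcup_const//; exists 0%N.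
- by move=> _ [A mA ->]; exact: m12.
Qed.

Lemma measurable_to_product_space d' (T : measurableType d')
    (f : T -> product_space S) :
  (forall i, measurable_fun setT (fun x => f x i)) -> measurable_fun setT f.
Proof.
move=> mf; apply: (@measurability _ _ T (product_space S) setT f
  (coordinate_sets S)); first by [].
move=> _ [_ [i [A [mA ->]]] <-].
exact: (mf i measurableT A mA).
Qed.

Lemma measurable_replace_coord (i : 'I_n) d' (T : measurableType d')
    (f : T -> product_space S) (h : T -> S i) :
  measurable_fun setT f -> measurable_fun setT h ->
  measurable_fun setT (fun x => replace_coord (f x) (h x)).
Proof.
move=> mf mh; apply: measurable_to_product_space => j.
rewrite /replace_coord; have [ij|ij] := eqVneq i j.
  (* The type [S i] depends on the index, so [i = j] is eliminated rather than rewritten. *)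
  case: _ / ij.
  have -> : (fun x => dfwith (f x) i (h x) i) = h.
    by apply/funext => x; rewrite dfwithin.
  exact: mh.
have -> : (fun x => dfwith (f x) i (h x) j) = (fun z => z j) \o f.
  by apply/funext => x; rewrite dfwithout.
exact: (measurableT_comp (measurable_coordinate S j) mf).
Qed.

End product_space_theory.

Section resampling.
Context {R : realType} {d0} {Omega : measurableType d0}
  (P : probability Omega R).
Context {n : nat} {d : 'I_n -> measure_display}
  {S : forall i, measurableType (d i)}.
Variable Z : Omega -> product_space S.
Hypotheses (mZ : measurable_fun setT Z) (indepZ : independent_components P Z).

Let mZi i : measurable_fun setT (fun w => Z w i).
Proof. exact: (measurableT_comp (measurable_coordinate S i) mZ). Qed.

(** The independent copy of the [i]-th coordinate lives on the second factor of [Omega * Omega]. *)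
Definition resample (i : 'I_n) (w : Omega * Omega) : product_space S :=
  replace_coord (Z w.1) (Z w.2 i).

Lemma measurable_resample i : measurable_fun setT (resample i).
Proof.
apply: measurable_replace_coord; first exact: measurableT_comp.
exact: (measurableT_comp (@mZi i) measurable_snd).
Qed.

(** It suffices to compare rectangles, where independence gives both sides the same product of
    marginal probabilities. *)
Lemma resample_law i (E : set (product_space S)) : measurable E ->
  pushforward P Z E = pushforward (P \x P)%E (resample i) E.
Proof.
move=> mE; have mR := measurable_resample i.
apply: (@eq_measure_rectangle _ _ _ R (pushforward P Z)
  (pushforward (P \x P)%E (resample i))) => //.
  by rewrite /= /pushforward preimage_setT probability_setT ltry.
move=> A mA; rewrite /= /pushforward.
have -> : Z @^-1` rectangle A =
    [set w | forall j, j \in [set: 'I_n]%SET -> A j (Z w j)].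
  by apply/seteqP; split => [w Aw j _|w Aw j]; apply: Aw; rewrite ?in_setT.
have -> : resample i @^-1` rectangle A =
    [set w | forall j, j \in [set~ i]%SET -> A j (Z w j)] `*`
    [set w | A i (Z w i)].
  apply/seteqP; split => [w Aw|w [/= A1 A2] j].
    split => /= [j|]; last first.
      by have := Aw i; rewrite /resample /replace_coord dfwithin.
    rewrite !finset.inE => ji; have := Aw j.
    by rewrite /resample /replace_coord dfwithout// eq_sym.
  rewrite /resample /replace_coord; case: dfwithP => // k ik.
  by apply: A1; rewrite !finset.inE eq_sym.
rewrite product_measure1E; last 2 first.
- have -> : [set w | forall j, j \in [set~ i]%SET -> A j (Z w j)] =
     \bigcap_(j in [set j | j \in [set~ i]%SET]) ((fun w => Z w j) @^-1` A j).
    by apply/seteqP; split.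
  apply: fin_bigcap_measurable => // j _.
  by rewrite -[X in measurable X]setTI; exact: mZi.
- by rewrite -[X in measurable X]setTI; exact: mZi.
rewrite /= !indepZ// (bigD1 i) ?finset.inE//= muleC; congr (_ * _)%E.
by apply: eq_bigl => j; rewrite !finset.inE.
Qed.

(** Under independence, a version of the conditional expectation of [f (Z)] given all coordinates
    but the [i]-th. *)
Definition average (i : 'I_n) (f : product_space S -> R)
    (z : product_space S) : R :=
  \int[P]_w f (replace_coord z (Z w i)).

Section average.
Variables (f : product_space S -> R) (M : R).
Hypotheses (mf : measurable_fun setT f) (fM : forall z, `|f z| <= M).

Lemma measurable_replace_section (i : 'I_n) (z : product_space S) :
  measurable_fun setT (fun w => f (replace_coord z (Z w i))).
Proof.
by apply: (measurableT_comp mf); apply: measurable_replace_coord.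
Qed.

Lemma integrable_replace_section (i : 'I_n) (z : product_space S) :
  P.-integrable setT (EFin \o (fun w => f (replace_coord z (Z w i)))).
Proof.
apply: (@bounded_integrable _ _ _ _ _ M) => //.
exact: measurable_replace_section.
Qed.

Lemma average_bounded i z : `|average i f z| <= M.
Proof.
apply: le_trans.
  exact: le_normr_Rintegral measurableT (integrable_replace_section i z).
rewrite -[leRHS](Rintegral_probability_cst P); apply: le_Rintegral => //.
- apply: (@bounded_integrable _ _ _ _
    (fun w => `|f (replace_coord z (Z w i))|) M) => //.
    apply: measurableT_comp => //; exact: measurable_replace_section.
  by move=> w; rewrite normr_id.
- by apply: (@bounded_integrable _ _ _ _ (cst M) `|M|).
Qed.

Lemma measurable_average i : measurable_fun setT (average i f).
Proof.
have [w0 _] := probability_nonempty P.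
pose F (x : product_space S * Omega) := f (replace_coord x.1 (Z x.2 i)).
have mF : measurable_fun setT F.
  apply: (measurableT_comp mf); apply: measurable_replace_coord => //.
  exact: (measurableT_comp (@mZi i) measurable_snd).
(* Fubini's measurability statement needs some measure on the first factor; a Dirac mass serves. *)
have iF : (\d_(Z w0) \x P)%E.-integrable setT (EFin \o F).
  by apply: (@bounded_integrable _ _ _ (\d_(Z w0) \x P)%E _ M) => // x; exact: fM.
apply: (measurableT_comp (fine_measurable measurableT)).
exact: (measurable_fubini_F iF).
Qed.

(** By Fubini the left side is the mean of [f] at the resampled point, which has the law of [Z]. *)
Lemma expectation_average i :
  \int[P]_w average i f (Z w) = \int[P]_w f (Z w).
Proof.
have mR := measurable_resample i.
have mfR : measurable_fun setT (f \o resample i) by exact: measurableT_comp.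
have ifR : (P \x P)%E.-integrable setT (EFin \o (f \o resample i)).
  by apply: (@bounded_integrable _ _ _ (P \x P)%E _ M) => // x; exact: fM.
have ifZ : P.-integrable setT (EFin \o (f \o Z)).
  apply: (@bounded_integrable _ _ _ P _ M); first exact: measurableT_comp.
  by move=> w; exact: fM.
congr fine.
transitivity (\int[P]_w fubini_F P (EFin \o (f \o resample i)) w)%E.
  apply: eq_integral => w _; rewrite fineK//.
  by apply: integrable_fin_num => //; exact: integrable_replace_section.
rewrite integral12_prod_meas1//.
have mfE : measurable_fun setT (EFin \o f) by exact/measurable_EFinP.
transitivity (\int[pushforward (P \x P)%E (resample i)]_z (f z)%:E)%E.
  by rewrite (integral_pushforward mR mfE).
transitivity (\int[pushforward P Z]_z (f z)%:E)%E.
  apply: eq_measure_integral => A mA _; exact: (esym (resample_law i mA)).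
by rewrite (integral_pushforward mZ mfE).
Qed.

End average.

End resampling.

(** * McDiarmid's inequality *)

Section replace_coord_theory.
Context {n : nat} {d : 'I_n -> measure_display}
  {S : forall i, measurableType (d i)}.
Implicit Types z : product_space S.

Lemma replace_coord_same z i (y y' : S i) :
  replace_coord (replace_coord z y) y' = replace_coord z y'.
Proof.
apply: functional_extensionality_dep => j; rewrite /replace_coord.
have [ij|ij] := eqVneq i j; last by rewrite !dfwithout.
by case: _ / ij; rewrite !dfwithin.
Qed.

Lemma replace_coord_id z i : replace_coord z (z i) = z.
Proof.
apply: functional_extensionality_dep => j; rewrite /replace_coord.
by case: dfwithP.
Qed.

Lemma replace_coord_comm z i j (x : S i) (y : S j) : i != j ->
  replace_coord (replace_coord z x) y = replace_coord (replace_coord z y) x.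
Proof.
move=> ij; apply: functional_extensionality_dep => k; rewrite /replace_coord.
have [ik|ik] := eqVneq i k.
  by case: _ / ik; rewrite dfwithin dfwithout 1?eq_sym// dfwithin.
have [jk|jk] := eqVneq j k; last by rewrite !dfwithout.
by case: _ / jk; rewrite dfwithin dfwithout// dfwithin.
Qed.

Lemma replace_coord_constant (T : Type) (f : product_space S -> T) :
  (forall z i (y : S i), f (replace_coord z y) = f z) ->
  forall z z', f z = f z'.
Proof.
move=> fr z z'.
(* [h l] agrees with [z'] on [l] and with [z] elsewhere; each new index changes one coordinate. *)
pose h (l : seq 'I_n) : product_space S :=
  fun j => if j \in l then z' j else z j.
have -> : z' = h (enum 'I_n).
  by apply: functional_extensionality_dep => j; rewrite /h mem_enum.
elim: (enum 'I_n) => [//|i l ->].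
rewrite -(fr (h l) i (z' i)); congr f.
apply: functional_extensionality_dep => j; rewrite /h /replace_coord inE.
have [->|ij] := eqVneq j i; first by rewrite dfwithin.
by rewrite dfwithout// eq_sym.
Qed.

End replace_coord_theory.

Section mcdiarmid.
Context {R : realType} {d0} {Omega : measurableType d0}
  (P : probability Omega R).
Context {n : nat} {d : 'I_n -> measure_display}
  {S : forall i, measurableType (d i)}.
Variable Z : Omega -> product_space S.
Hypotheses (mZ : measurable_fun setT Z) (indepZ : independent_components P Z).

(** One-sided, but putting the old coordinate back gives the opposite sign. *)
Definition bounded_differences (f : product_space S -> R) (c : 'I_n -> R) :=
  forall z i (y : S i), f (replace_coord z y) - f z <= c i.

(** Averaging removes the dependence on coordinate [i]. For the others the bound passes under the
    integral, as replacements at distinct indices commute. *)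
Lemma bounded_differences_average (f : product_space S -> R) (M : R)
    (c : 'I_n -> R) i :
  measurable_fun setT f -> (forall z, `|f z| <= M) -> bounded_differences f c ->
  bounded_differences (average P Z i f) (fun j => if j == i then 0 else c j).
Proof.
move=> mf fM fc z j y; have [ji|ji] := eqVneq j i.
  move: y; rewrite ji => y; rewrite subr_le0 /average.
  by under eq_Rintegral do rewrite replace_coord_same.
have intf := integrable_replace_section P mZ mf fM.
rewrite /average -RintegralB//; try exact: intf.
rewrite -[leRHS](Rintegral_probability_cst P); apply: le_Rintegral => //.
- apply: (integrableB measurableT (intf i _) (intf i _)).
- by apply: (@bounded_integrable _ _ _ _ (cst (c j)) `|c j|).
- by move=> w _; rewrite replace_coord_comm.
Qed.

(** Hoeffding's lemma with all coordinates but the [i]-th frozen at those of [z]. *)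
Lemma average_expR (f : product_space S -> R) (M : R) (c : 'I_n -> R) i h z :
  measurable_fun setT f -> (forall z, `|f z| <= M) -> bounded_differences f c ->
  average P Z i (fun z => expR (h * f z)) z <=
  expR (h * average P Z i f z + h ^+ 2 * c i ^+ 2 / 8).
Proof.
move=> mf fM fc; apply: (@hoeffding_lemma _ _ _ P _ _ M) => //.
- exact: (measurable_replace_section mZ mf).
- move=> x y; rewrite -(replace_coord_same z (Z y i) (Z x i)); exact: fc.
Qed.

Lemma expR_bounded (f : product_space S -> R) (M h : R) :
  (forall z, `|f z| <= M) -> forall z, `|expR (h * f z)| <= expR (`|h| * M).
Proof.
move=> fM z; rewrite ger0_norm ?expR_ge0// ler_expR.
by rewrite (le_trans (ler_norm _))// normrM ler_wpM2l.
Qed.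

Lemma measurable_expR_scale d' (T : measurableType d') (f : T -> R) (h : R) :
  measurable_fun setT f -> measurable_fun setT (fun z => expR (h * f z)).
Proof.
by move=> mf; apply: measurableT_comp => //; exact: measurable_funM.
Qed.

(* [f] has difference bound 0 in the coordinates outside [s], hence does not
   depend on them: the induction averages out the coordinates in [s]. *)
Lemma mgf_bounded_differences (s : seq 'I_n) (f : product_space S -> R)
    (M h : R) (c : 'I_n -> R) :
  measurable_fun setT f -> (forall z, `|f z| <= M) -> (forall i, 0 <= c i) ->
  bounded_differences f (fun i => if i \in s then c i else 0) ->
  \int[P]_w expR (h * f (Z w)) <=
  expR (h * \int[P]_w f (Z w) + h ^+ 2 * (\sum_(i <- s) c i ^+ 2) / 8).
Proof.
move=> mf fM c0; elim: s f mf fM => [|i s IH] f mf fM fc.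
  have [w0 _] := probability_nonempty P.
  have fr z i (y : S i) : f (replace_coord z y) = f z.
    apply/eqP; rewrite eq_le -subr_le0 (fc z i y)/= -subr_le0.
    have := fc (replace_coord z y) i (z i).
    by rewrite replace_coord_same replace_coord_id.
  have fz z : f z = f (Z w0) by exact: replace_coord_constant.
  under eq_Rintegral do rewrite fz.
  under [X in _ <= expR (h * X + _)]eq_Rintegral do rewrite fz.
  rewrite !Rintegral_probability_cst big_nil mulr0 mul0r addr0; lra.
set g := average P Z i f.
have mg : measurable_fun setT g by exact: (measurable_average P mZ mf fM).
have gM z : `|g z| <= M by exact: (average_bounded P mZ mf fM).
have cgd : bounded_differences g (fun j => if j \in s then c j else 0).
  move=> z j y; apply: le_trans (bounded_differences_average i mf fM fc z y) _.
  by rewrite inE; case: (j == i) => //; case: ifP.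
have me := measurable_expR_scale h mf.
have eM := expR_bounded h fM.
(* Tower property: the exponential is first averaged over coordinate [i], where [average_expR]
   leaves a constant factor times [expR (h * g)]; the induction hypothesis then handles [g]. *)
rewrite -(expectation_average mZ indepZ me eM i).
have := IH g mg gM cgd.
rewrite (expectation_average mZ indepZ mf fM) => IHg.
apply: (@le_trans _ _
    (\int[P]_w (expR (h ^+ 2 * c i ^+ 2 / 8) * expR (h * g (Z w))))).
  have eZ : measurable_fun setT (fun w => expR (h * g (Z w))).
    by apply: measurable_expR_scale; exact: measurableT_comp.
  apply: le_Rintegral => //.
  - apply: (@bounded_integrable _ _ _ P _ (expR (`|h| * M))).
      exact: (measurableT_comp (measurable_average P mZ me eM i) mZ).
    by move=> w; exact: (average_bounded P mZ me eM).
  - apply: (@bounded_integrable _ _ _ P _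
      (expR (h ^+ 2 * c i ^+ 2 / 8) * expR (`|h| * M))).
      exact: measurable_funM.
    move=> w; rewrite normrM ger0_norm ?expR_ge0//.
    by rewrite ler_wpM2l ?expR_ge0// expR_bounded.
  - move=> w _; rewrite -expRD addrC.
    have := average_expR i h (Z w) mf fM fc; rewrite mem_head; exact.
rewrite RintegralZl//; last first.
  apply: (@bounded_integrable _ _ _ P _ (expR (`|h| * M))).
    by apply: measurable_expR_scale; exact: measurableT_comp.
  by move=> w; exact: expR_bounded.
rewrite big_cons.
apply: (le_trans (ler_wpM2l (expR_ge0 _) IHg)).
by rewrite -expRD ler_expR; lra.
Qed.

Lemma mcdiarmid_upper (f : product_space S -> R) (M u : R) (c : 'I_n -> R) :
  measurable_fun setT f -> (forall z, `|f z| <= M) -> (forall i, 0 <= c i) ->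
  bounded_differences f c -> 0 < u -> 0 < \sum_i c i ^+ 2 ->
  (P [set w | (u <= f (Z w) - \int[P]_w f (Z w))%R] <=
   (expR (- 2 * u ^+ 2 / \sum_i c i ^+ 2))%:E)%E.
Proof.
move=> mf fM c0 fc u0; set C := \sum_i _ => C0; set E := \int[P]_w _.
have mfZ : measurable_fun setT (f \o Z) by exact: measurableT_comp.
pose X : {RV P >-> R} := mfun_Sub (mem_set mfZ).
(* The minimizer of the Chernoff exponent [h^2 C / 8 - h u], with minimum [- 2 u^2 / C]. *)
pose h := 4 * u / C.
have h0 : 0 < h by rewrite divr_gt0// mulr_gt0.
have := chernoff X (u + E) h0.
have -> : [set x | u + E <= X x] = [set w | (u <= f (Z w) - E)%R].
  by apply/seteqP; split => w /=; rewrite lerBrDr.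
move=> /le_trans; apply.
have -> : ('M_P X h = (\int[P]_w expR (h * f (Z w)))%:E)%E.
  rewrite /mmt_gen_fun unlock /Rintegral fineK; last first.
    apply: integrable_fin_num => //.
    apply: (@bounded_integrable _ _ _ P _ (expR (`|h| * M))).
      exact: measurable_expR_scale.
    by move=> w; exact: expR_bounded.
  by apply: eq_integral => w _ /=; rewrite mulrC.
rewrite -EFinM lee_fin.
have fc' : bounded_differences f
    (fun i => if i \in index_enum 'I_n then c i else 0).
  by move=> z i y; rewrite mem_index_enum; exact: fc.
have := mgf_bounded_differences h mf fM c0 fc'; rewrite -/C -/E.
move=> /(ler_wpM2r (expR_ge0 (- (h * (u + E))))) /le_trans; apply.
rewrite -expRD ler_expR /h.
by rewrite le_eqVlt; apply/orP; left; apply/eqP; field; rewrite lt0r_neq0.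
Qed.

Lemma mcdiarmid_centered (f : product_space S -> R) (M u : R) (c : 'I_n -> R) :
  measurable_fun setT f -> (forall z, `|f z| <= M) -> (forall i, 0 <= c i) ->
  bounded_differences f c -> \int[P]_w f (Z w) = 0 ->
  0 < u -> 0 < \sum_i c i ^+ 2 ->
  (P [set w | (u <= `|f (Z w)|)%R] <=
   (2 * expR (- 2 * u ^+ 2 / \sum_i c i ^+ 2))%:E)%E.
Proof.
move=> mf fM c0 fc f0 u0 C0.
have mN : measurable_fun setT (fun z => - f z) by exact: measurable_funN.
have intf : P.-integrable setT (EFin \o (f \o Z)).
  apply: (@bounded_integrable _ _ _ P _ M); first exact: measurableT_comp.
  by move=> w; exact: fM.
have N0 : \int[P]_w - f (Z w) = 0.
  under eq_Rintegral do rewrite -mulN1r.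
  by rewrite RintegralZl// f0 mulr0.
have := mcdiarmid_upper mf fM c0 fc u0 C0; rewrite f0 => up.
have := @mcdiarmid_upper (fun z => - f z) M u c mN; rewrite N0 => lo.
have m_up (h : product_space S -> R) : measurable_fun setT h ->
    measurable [set w | u <= h (Z w)].
  move=> mh; have -> : [set w | u <= h (Z w)] = (h \o Z) @^-1` `[u, +oo[.
    by apply/seteqP; split => w /=; rewrite in_itv/= andbT.
  rewrite -[X in measurable X]setTI; apply: (measurableT_comp mh mZ) => //.
have -> : [set w | u <= `|f (Z w)|] =
    [set w | u <= f (Z w)] `|` [set w | u <= - f (Z w)].
  apply/seteqP; split => w /=; rewrite ler_normr; first by move/orP.
  by move=> h; apply/orP.
apply: (le_trans (measureU2 P (m_up _ mf) (m_up _ mN))).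
rewrite mulr_natl mulr2n EFinD; apply: leeD.
  apply: le_trans up.
  by under eq_set do rewrite -[f (Z _)]subr0.
apply: le_trans (lo _ c0 _ u0 C0).
- by under eq_set do rewrite -[- f (Z _)]subr0.
- by move=> z; rewrite normrN.
- move=> z i y; rewrite opprK addrC.
  have := fc (replace_coord z y) i (z i).
  by rewrite replace_coord_same replace_coord_id.
Qed.

End mcdiarmid.

(** * Nets along the arc length *)

Section derivable_on_theory.
Context {R : realType}.
Implicit Types (A : set R) (f : R -> R) (x : R).

Lemma derivable_on_cvg A f x : derivable_on A f x ->
  f y @[y --> within A x^'] --> f x.
Proof.
move=> df.
have idx : (y : R) @[y --> within A x^'] --> x.
  by move=> U Ux; apply: filterS Ux => y Uy _ _.
have lin : (f y - f x) / (y - x) * (y - x) + f x @[y --> within A x^'] -->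
    derive_on A f x * (x - x) + f x.
  apply: cvgD; last exact: cvg_cst.
  by apply: cvgM => //; apply: cvgB => //; exact: cvg_cst.
move: lin; rewrite subrr mulr0 add0r; apply: cvg_trans; apply: near_eq_cvg.
suff : nbhs x (fun y => y != x -> A y ->
    (f y - f x) / (y - x) * (y - x) + f x = f y) by [].
by apply: filterE => y yx _; rewrite divfK ?subr_eq0// subrK.
Qed.

(** Near an interior point the restriction to [A] is invisible, so the relative derivative is the
    ordinary one. *)
Lemma derivable_on_interior A f x : nbhs x A -> derivable_on A f x ->
  is_derive x 1 f (derive_on A f x).
Proof.
move=> Ax df.
have sh : (h + x) @[h --> 0^'] --> within A x^'.
  move=> U nU.
  have shc : (h + x) @[h --> (0 : R)] --> (0 : R) + x.
    by apply: cvgD; [exact: cvg_id|exact: cvg_cst].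
  have nU' : nbhs (0 + x) (fun y => y != x -> U y).
    rewrite add0r; apply: filterS2 Ax nU => y Ay yU yx; exact: yU.
  suff : nbhs (0 : R) (fun h => h != 0 -> U (h + x)) by [].
  have {}shc : nbhs (0 : R) (fun h => h + x != x -> U (h + x)).
    exact: (shc _ nU').
  apply: filterS shc => h hU h0; apply: hU.
  by rewrite -subr_eq0 addrK.
have H : h^-1 *: ((f \o shift x) (h *: 1) - f x) @[h --> 0^'] -->
    derive_on A f x.
  have -> : (fun h : R => h^-1 *: ((f \o shift x) (h *: 1) - f x)) =
      (fun y => (f y - f x) / (y - x)) \o (fun h => h + x).
    apply/funext => h /=; rewrite addrK /GRing.scale/= mulr1 mulrC//.
  by apply: cvg_comp sh _; exact: df.
by split; [apply/cvg_ex; eexists; exact: H|exact: cvg_lim].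
Qed.

Context (a b : R).

Lemma derivable_on_cvg_right f s : a <= s < b -> derivable_on `[a, b] f s ->
  f y @[y --> s^'+] --> f s.
Proof.
move=> /andP[ks sb] /derivable_on_cvg; apply: cvg_trans.
apply: cvg_app => U nU.
apply: filterS2 (lt_nbhsl sb) nU => y yb yU sy.
by apply: yU; rewrite ?gt_eqF//= in_itv/= (ltW yb) (le_trans ks (ltW sy)).
Qed.

Lemma derivable_on_cvg_left f s : a < s <= b -> derivable_on `[a, b] f s ->
  f y @[y --> s^'-] --> f s.
Proof.
move=> /andP[ks sb] /derivable_on_cvg; apply: cvg_trans.
apply: cvg_app => U nU.
apply: filterS2 (lt_nbhsr ks) nU => y yb yU sy.
by apply: yU; rewrite ?lt_eqF//= in_itv/= (ltW yb) (le_trans (ltW sy) sb).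
Qed.

Lemma within_continuous_subset f s t : a <= s -> t <= b ->
  {within `[a, b], continuous f} -> {within `[s, t], continuous f}.
Proof.
move=> ks tb; apply: continuous_subspaceW => x /=.
rewrite !in_itv/= => /andP[sx xt].
by rewrite (le_trans ks sx) (le_trans xt tb).
Qed.

(** Ordinary derivatives are available strictly between [s] and [t]; at these endpoints one-sided
    continuity of [f] is enough. *)
Lemma C1_on_FTC f s t : C1_on `[a, b] f -> a <= s -> s < t -> t <= b ->
  \int[lebesgue_measure]_(x in `[s, t]) derive_on `[a, b] f x = f t - f s.
Proof.
move=> [df cf] ks st tb.
have dI x : s < x < t -> is_derive x 1 f (derive_on `[a, b] f x).
  move=> /andP[sx xt]; have ax := le_lt_trans ks sx; have xb := lt_le_trans xt tb.
  apply: derivable_on_interior; last by apply: df; rewrite /= in_itv/= !ltW.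
  apply: (@filterS _ _ _ [set` `]a, b[]); first exact: subset_itv_oo_cc.
  by apply: near_in_itvoo; rewrite in_itv/= ax xb.
rewrite /Rintegral (@continuous_FTC2 _ _ f)//.
- exact: within_continuous_subset cf.
- split.
  + by move=> x; rewrite in_itv/= => /dI ?; exact: ex_derive.
  + apply: derivable_on_cvg_right; first by rewrite ks (lt_le_trans st tb).
    by apply: df; rewrite /= in_itv/= ks (le_trans (ltW st) tb).
  + apply: derivable_on_cvg_left; first by rewrite tb (le_lt_trans ks st).
    by apply: df; rewrite /= in_itv/= tb (le_trans ks (ltW st)).
- by move=> x; rewrite in_itv/= => /dI ?; rewrite derive1E derive_val.
Qed.

Lemma C1_on_integrable f s t : C1_on `[a, b] f -> a <= s -> t <= b ->
  lebesgue_measure.-integrable `[s, t] (EFin \o derive_on `[a, b] f).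
Proof.
move=> [_ cf] ks tb; apply: continuous_compact_integrable.
  exact: segment_compact.
exact: within_continuous_subset cf.
Qed.

End derivable_on_theory.

(** Will locate an arc length in one of [N] equal cells; [e = 0] is allowed, which covers a curve of
    length zero. *)
Lemma uniform_grid (R : realDomainType) (e x : R) N : (0 < N)%N ->
  0 <= x <= e * N%:R -> exists k : 'I_N, e * k%:R <= x <= e * k.+1%:R.
Proof.
elim: N => [//|[_ _|N IH _]] /andP[x0 xN].
  by exists ord0; rewrite mulr0 x0.
have [xN'|xN'] := leP x (e * N.+1%:R); last first.
  by exists ord_max; rewrite (ltW xN') xN.
have [||k] := IH => //; first by rewrite x0.
by exists (widen_ord (leqnSn _) k).
Qed.

Section arc_length.
Context {R : realType} (T : R) (m : nat) (psi : 'I_m -> R -> R).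
Hypotheses (T0 : 0 < T) (psi_C1 : forall j, C1_on `[0, T] (psi j)).

Let speed (s : R) : R := \sum_(j < m) `|derive_on `[0, T] (psi j) s|.

Let intD s t j : 0 <= s -> t <= T ->
  lebesgue_measure.-integrable `[s, t]
    (fun x => `|derive_on `[0, T] (psi j) x|%:E).
Proof.
move=> s0 tT.
exact: (integrable_abse (C1_on_integrable (psi_C1 j) s0 tT)).
Qed.

Let integrable_speed s t : 0 <= s -> t <= T ->
  lebesgue_measure.-integrable `[s, t] (EFin \o speed).
Proof.
move=> s0 tT.
have -> : EFin \o speed =
    (fun x => \sum_(j < m) `|derive_on `[0, T] (psi j) x|%:E)%E.
  by apply/funext => x; rewrite /= /speed sumEFin.
by apply: integrable_sum => // j _; exact: intD.
Qed.

Let a (t : R) : R := \int[lebesgue_measure]_(x in `[0, t]) speed x.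

(** Each increment is the integral of a derivative, and the norm passes inside the integral. *)
Lemma increment_le_arc s t : 0 <= s -> s <= t -> t <= T ->
  \sum_(j < m) `|psi j t - psi j s| <= a t - a s.
Proof.
move=> s0; rewrite le_eqVlt => /predU1P[-> _|st tT].
  by rewrite subrr big1// => j _; rewrite subrr normr0.
have ok0 : lebesgue_measure.-integrable `]s, t] (EFin \o speed).
  apply: integrableS (integrable_speed s0 tT) => //.
  exact: subset_itv_oc_cc.
rewrite /a Rintegral_itvB//; last first.
- by rewrite bnd_simp ltW.
- by apply: integrable_speed.
rewrite Rintegral_itv_obnd_cbnd//.
have -> : \int[lebesgue_measure]_(x in `[s, t]) speed x =
    \sum_(j < m) \int[lebesgue_measure]_(x in `[s, t])
      `|derive_on `[0, T] (psi j) x|.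
  rewrite /Rintegral.
  under eq_integral do rewrite /speed -sumEFin.
  rewrite integral_sum//; last by move=> j; exact: intD.
  rewrite -sum_fine// => j _; apply: integrable_fin_num => //; exact: intD.
apply: ler_sum => j _.
rewrite -(C1_on_FTC (psi_C1 j))//; apply: le_normr_Rintegral => //.
exact: C1_on_integrable.
Qed.

Lemma arc_ge0 : 0 <= arc_l1 T psi.
Proof. by apply: Rintegral_ge0 => x _; apply: sumr_ge0. Qed.

Lemma arc_grid (N : nat) : (0 < N)%N ->
  exists tk : 'I_N -> R, (forall k, tk k \in `[0, T]) /\
    forall t, t \in `[0, T] -> exists k,
      \sum_(j < m) `|psi j t - psi j (tk k)| <= arc_l1 T psi / (2 * N%:R).
Proof.
move=> N0; have N0R : 0 < N%:R :> R by rewrite ltr0n.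
set L := arc_l1 T psi; have L0 : 0 <= L := arc_ge0.
have aT : a T = L by [].
have a0 : a 0 = 0 by rewrite /a set_itv1 Rintegral_set1.
have ca : {within `[0, T], continuous a}.
  apply: parameterized_integral_continuous; first exact: ltW.
  exact: integrable_speed.
pose e := L / N%:R.
have e0 : 0 <= e by rewrite divr_ge0.
have eN : e * N%:R = L by rewrite divfK// lt0r_neq0.
(* Net times sit at the midpoints of the arc-length cells, so every time is within half a cell of
   one; they exist by the intermediate value theorem. *)
have tkP (k : 'I_N) : exists t, t \in `[0, T] /\ a t = e * k%:R + e / 2.
  have [|t tT at_] := @IVT _ a 0 T (e * k%:R + e / 2) (ltW T0) ca.
    rewrite a0 aT min_l// max_r// -eN.
    have : e * k.+1%:R <= e * N%:R by rewrite ler_wpM2l// ler_nat.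
    have : 0 <= e * k%:R by rewrite mulr_ge0.
    rewrite -natr1 mulrDr mulr1; lra.
  by exists t.
have [tk tkP'] := choice tkP.
exists tk; split => [k|t tT]; first by have [] := tkP' k.
move: (tT); rewrite in_itv/= => /andP[t0 tT'].
have a_mono s t' : 0 <= s -> s <= t' -> t' <= T -> a s <= a t'.
  move=> s0 st tT''; rewrite -subr_ge0.
  apply: le_trans (increment_le_arc s0 st tT''); exact: sumr_ge0.
have [|k kP] := @uniform_grid R e (a t) N N0.
  by rewrite eN -{1}a0 -aT !a_mono.
exists k; have [] := tkP' k; rewrite in_itv/= => /andP[k0 kT] ak.
have -> : L / (2 * N%:R) = e / 2 by rewrite /e; field; rewrite lt0r_neq0.
move: kP; rewrite -natr1 mulrDr mulr1 => kP.
have [tk_t|t_tk] := leP (tk k) t.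
  apply: le_trans (increment_le_arc k0 tk_t tT') _; rewrite ak; lra.
under eq_bigr do rewrite distrC.
apply: le_trans (increment_le_arc t0 (ltW t_tk) kT) _; rewrite ak; lra.
Qed.

End arc_length.

(** * The size of the net *)

Section grid_size.
Context {R : realType}.

Lemma expR1_le4 : expR 1 <= 4 :> R.
Proof.
(* From [1 - 1/2 <= expR (- 1/2)]; squaring gives the claim. *)
have h : expR (2^-1 : R) <= 2.
  rewrite -[expR _]invrK -expRN -[leRHS]invrK lef_pV2 ?posrE ?expR_gt0//.
  by apply: le_trans (expR_ge1Dx _); lra.
have -> : expR 1 = expR 2^-1 * expR 2^-1 :> R.
  by rewrite -expRD; congr expR; field.
have -> : (4 : R) = 2 * 2 by ring.
by rewrite ler_pM ?expR_ge0.
Qed.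

Lemma ln4_ge1 : 1 <= ln 4 :> R.
Proof. by rewrite -[leLHS](@expRK R) ler_ln ?posrE ?expR_gt0// expR1_le4. Qed.

Lemma exists_nat_between (z : R) : 0 <= z ->
  exists2 N, (0 < N)%N & z <= N%:R <= z + 1.
Proof.
move=> z0; exists (Num.truncn z).+1 => //.
by have /andP[h1 h2] := truncn_itv z0; rewrite (ltW h2) -natr1 lerD2r.
Qed.

(** Exponentiated, this reads [e^4 L <= (e + L)^4]; as [e <= 4], the binomial term [4 e^3 L]
    suffices. *)
Lemma ln_le_4ln (L : R) : 0 < L -> ln L + 4 <= 4 * ln (expR 1 + L).
Proof.
move=> L0; set e := expR 1 : R; have e0 : 0 < e := expR_gt0 _.
have eL0 : 0 < e + L by exact: addr_gt0.
have -> : ln L + 4 = ln (L * e ^+ 4).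
  by rewrite lnM ?posrE ?exprn_gt0// lnXn// /e expRK.
have -> : 4 * ln (e + L) = ln ((e + L) ^+ 4) by rewrite lnXn// mulr_natl.
rewrite ler_ln ?posrE ?mulr_gt0 ?exprn_gt0//.
apply: (@le_trans _ _ (4 * e ^+ 3 * L)).
  rewrite mulrC exprS ler_wpM2r ?(ltW L0)// ler_wpM2r ?exprn_ge0 ?(ltW e0)//.
  exact: expR1_le4.
rewrite -subr_ge0.
have -> : (e + L) ^+ 4 - 4 * e ^+ 3 * L =
  e ^+ 4 + 6 * (e ^+ 2 * L ^+ 2) + 4 * (e * L ^+ 3) + L ^+ 4 by ring.
by rewrite !addr_ge0 ?mulr_ge0 ?exprn_ge0 ?ltW.
Qed.

(** This is what the union bound requires at the threshold [eps = sqrt (ln 4) / 2], where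
    [2 exp (- 2 eps^2) = 1]. *)
Lemma exists_grid_size (a eta : R) : 0 <= a -> 1 < eta ->
  exists2 N, (0 < N)%N &
    Num.sqrt (2 * ln (2 * N%:R)) + a * Num.sqrt eta / N%:R <=
    Num.sqrt (ln 4) * calR ((2 + a) ^+ 2 * eta).
Proof.
move=> a0 eta1; set q := Num.sqrt eta; set x := _ * eta.
have q1 : 1 < q by rewrite -[ltLHS]sqrtr1 ltr_sqrt// (lt_trans ltr01).
have q2 : q ^+ 2 = eta by rewrite sqr_sqrtr// (le_trans ler01)// ltW.
pose y := (2 + a) * q; pose A := a * q; rewrite -/A.
have A0 : 0 <= A by rewrite mulr_ge0//; lra.
have yA : A + 2 <= y by rewrite /y /A; nra.
have y0 : 0 < y by lra.
set K := Num.sqrt (ln 4).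
have K1 : 1 <= K.
  by rewrite -[leLHS]sqrtr1 ler_sqrt// ?ln4_ge1// (le_trans _ ln4_ge1).
have L_y : ln x = 2 * ln y.
  by rewrite mulr_natl -lnXn// /y exprMn q2.
have L1 : 1 <= ln x.
  apply: (le_trans ln4_ge1); rewrite ler_ln ?posrE//.
    have -> : x = y ^+ 2 by rewrite /y exprMn q2.
    have -> : (4 : R) = 2 ^+ 2 by ring.
    by rewrite ler_sqr ?nnegrE; lra.
  have -> : x = y ^+ 2 by rewrite /y exprMn q2.
  by rewrite exprn_gt0.
have K0 : 0 < K by lra.
set L := ln x in L_y L1 *; pose l := Num.sqrt L.
have l1 : 1 <= l by rewrite -[leLHS]sqrtr1 ler_sqrt// (le_trans _ L1).
have l2 : l ^+ 2 = L by rewrite sqr_sqrtr// (le_trans _ L1).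
have l0 : 0 < l by lra.
have -> : K * calR x = l + 2 * (K * Num.min 1 (ln (expR 1 + L) / l)).
  rewrite /calR mulrDr /log4 -/L sqrtrM ?(le_trans _ L1)//.
  rewrite sqrtrV ?(le_trans _ ln4_ge1)//.
  by rewrite -/K -/l; field; rewrite lt0r_neq0.
set v := ln (expR 1 + L).
have v0 : ln L + 4 <= 4 * v by apply: ln_le_4ln; lra.
have lnL0 : 0 <= ln L by rewrite ln_ge0.
(* [N] is the least integer above [A / s], so that [2 N <= 2 y / s]. *)
have suffN (s c : R) : 0 < s -> s <= 2 ->
    s + (Num.sqrt (L + 2 * ln (2 / s)) - l) <= c ->
    exists2 N, (0 < N)%N & Num.sqrt (2 * ln (2 * N%:R)) + A / N%:R <= l + c.
  move=> s0 s2 sc.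
  have [|N N0 /andP[N1 N2]] := @exists_nat_between (A / s).
    by rewrite divr_ge0// ltW.
  exists N => //.
  have NR0 : 0 < N%:R :> R by rewrite ltr0n.
  have AN : A / N%:R <= s by rewrite ler_pdivrMr// mulrC -ler_pdivrMr.
  suff : Num.sqrt (2 * ln (2 * N%:R)) <= Num.sqrt (L + 2 * ln (2 / s)) by lra.
  apply: ler_wsqrtr.
  have ys : 0 < 2 / s by rewrite divr_gt0.
  have NR20 : 0 < 2 * N%:R :> R by rewrite mulr_gt0.
  rewrite L_y -mulrDr ler_pM2l// -lnM// ler_ln ?posrE ?(mulr_gt0 y0 ys)//.
  rewrite mulrCA ler_pM2l//; apply: (le_trans N2).
  have -> : A / s + 1 = (A + s) / s by field; rewrite lt0r_neq0.
  by rewrite ler_pM2r ?invr_gt0//; lra.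
(* If the minimum is 1, then [s = 2] costs 2, at most [2 K] as [K >= 1]. Otherwise [s = 2 / l] makes
   [2 ln (2 / s)] equal to [ln L]. *)
case: leP => _.
  apply: (suffN 2) => //; rewrite mulr1 divff// ln1 mulr0 addr0 -/l subrr; lra.
apply: (suffN (2 / l)); first by rewrite divr_gt0.
  by rewrite ler_pdivrMr//; lra.
have -> : 2 / (2 / l) = l by field; rewrite lt0r_neq0.
have -> : 2 * ln l = ln L by rewrite -l2 lnXn// mulr_natl.
(* The tangent bound for the square root; the total cost becomes [(ln L + 4) / (2 l)], controlled by
   [ln_le_4ln]. *)
have sq : Num.sqrt (L + ln L) <= l + ln L / (2 * l).
  rewrite -[leRHS]ger0_norm; last first.
    by rewrite addr_ge0 ?(ltW l0)// divr_ge0// mulr_ge0// ltW.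
  rewrite -sqrtr_sqr ler_wsqrtr//.
  have -> : (l + ln L / (2 * l)) ^+ 2 = l ^+ 2 + ln L + (ln L / (2 * l)) ^+ 2.
    by field; rewrite lt0r_neq0.
  by rewrite l2 lerDl sqr_ge0.
apply: (@le_trans _ _ (2 / l + ln L / (2 * l))); first lra.
have -> : 2 / l + ln L / (2 * l) = (ln L + 4) / 2 / l.
  by field; rewrite lt0r_neq0.
rewrite !mulrA ler_pM2r ?invr_gt0//.
nra.
Qed.

(** Scaling up from the threshold by [t = eps / K >= 1/2] gives [sqrt eta * u >= t r]. Hence [2 eta
    u^2 >= 2 eps^2 + 2 (eps^2 / ln 2) ln N], and the last term is at least [ln N], which absorbs the
    factor [N]. *)
Lemma grid_size_tail (a eta eps Rx : R) (N : nat) :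
  0 <= a -> 1 < eta -> 0 < eps -> (0 < N)%N -> ln 2 <= 2 * eps ^+ 2 ->
  Num.sqrt (2 * ln (2 * N%:R)) + a * Num.sqrt eta / N%:R <=
    Num.sqrt (ln 4) * Rx ->
  let u := eps * Rx / Num.sqrt eta - a / (2 * N%:R) in
  0 < u /\ N%:R * expR (- 2 * u ^+ 2 * eta) <= expR (- 2 * eps ^+ 2).
Proof.
move=> a0 eta1 eps0 N0 epsl; set q := Num.sqrt eta; set K := Num.sqrt (ln 4).
set r := Num.sqrt (2 * _) => H u.
have N1 : 1 <= N%:R :> R by rewrite ler1n.
have q1 : 1 < q by rewrite -[ltLHS]sqrtr1 ltr_sqrt// (lt_trans ltr01).
have q2 : q ^+ 2 = eta by rewrite sqr_sqrtr// (le_trans ler01)// ltW.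
have ln40 : 0 < ln 4 :> R by rewrite (lt_le_trans ltr01)// ln4_ge1.
have K0 : 0 < K by rewrite sqrtr_gt0.
have K2 : K ^+ 2 = ln 4 by rewrite sqr_sqrtr// ltW.
have ln42 : ln 4 = 2 * ln 2 :> R.
  by rewrite mulr_natl -lnXn//; congr ln; ring.
have ln20 : 0 < ln 2 :> R by lra.
have lnN0 : 0 <= ln N%:R :> R by rewrite ln_ge0.
have l2N : ln (2 * N%:R) = ln 2 + ln N%:R :> R by rewrite lnM ?posrE//; lra.
have r2 : r ^+ 2 = 2 * (ln 2 + ln N%:R).
  by rewrite sqr_sqrtr ?l2N// mulr_ge0// addr_ge0// ltW.
have r0 : 0 < r by rewrite sqrtr_gt0 l2N; lra.
have Keps : K <= 2 * eps.
  rewrite -ler_sqr ?nnegrE ?K2 ?ln42 ?exprMn; nra.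
pose t := eps / K.
have t0 : 0 < t by rewrite divr_gt0.
have t2 : 1 / 2 <= t by rewrite ler_pdivlMr//; lra.
have qu : q * u = eps * Rx - a * q / N%:R / 2.
  by rewrite /u; field; rewrite !lt0r_neq0//; lra.
have aqN : 0 <= a * q / N%:R by rewrite divr_ge0 ?mulr_ge0//; lra.
(* Since [t >= 1/2], the net error [a q / (2 N)] is at most [t] times the term [a q / N] of the
   hypothesis. *)
have qur : t * r <= q * u.
  have -> : q * u = t * (K * Rx) - a * q / N%:R / 2.
    by rewrite qu /t; field; rewrite !lt0r_neq0//; lra.
  have : t * (r + a * q / N%:R) <= t * (K * Rx) by rewrite ler_pM2l.
  nra.
have u0 : 0 < u.
  have : 0 < q * u by rewrite (lt_le_trans _ qur)// mulr_gt0.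
  by rewrite pmulr_rgt0//; lra.
split => //.
have N0R : 0 < N%:R :> R by lra.
rewrite -[X in X * _]lnK ?posrE// -expRD ler_expR.
have : (t * r) ^+ 2 <= (q * u) ^+ 2.
  have tr0 : 0 < t * r by rewrite mulr_gt0.
  by rewrite ler_sqr ?nnegrE ?(ltW tr0)// (le_trans (ltW tr0)).
have -> : (t * r) ^+ 2 = t ^+ 2 * r ^+ 2 by ring.
have -> : (q * u) ^+ 2 = q ^+ 2 * u ^+ 2 by ring.
rewrite q2 r2.
have -> : t ^+ 2 = eps ^+ 2 / (2 * ln 2) by rewrite /t expr_div_n K2 ln42.
have -> : eps ^+ 2 / (2 * ln 2) * (2 * (ln 2 + ln N%:R)) =
    eps ^+ 2 + eps ^+ 2 / ln 2 * ln N%:R.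
  by field; rewrite lt0r_neq0.
have : 1 / 2 <= eps ^+ 2 / ln 2 by rewrite ler_pdivlMr//; lra.
move=> h1 h2.
have : 1 / 2 * ln N%:R <= eps ^+ 2 / ln 2 * ln N%:R by rewrite ler_wpM2r.
lra.
Qed.

End grid_size.

(** * The supremum of a linear process *)

Lemma calR_gt0 (R : realType) (x : R) : 1 < x -> 0 < calR x.
Proof.
move=> x1; have lx : 0 < ln x by rewrite ln_gt0.
have l4 : 0 < ln 4 :> R by rewrite (lt_le_trans ltr01)// ln4_ge1.
rewrite /calR ltr_pwDl ?sqrtr_gt0 ?divr_gt0// mulr_ge0// le_min ler01/=.
rewrite divr_ge0 ?sqrtr_ge0// ln_ge0//.
have := expR_ge1Dx (1 : R); lra.
Qed.

Section sup_grid.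
Context {R : realType} (h : R -> R) (D : set R) (delta b : R).
Variables (N : nat) (tk : 'I_N.+1 -> R).
Hypotheses (Dtk : forall k, D (tk k)) (hb : forall t, D t -> h t <= b).

Lemma le_sup_image t : D t -> h t <= sup [set h t | t in D].
Proof.
move=> Dt; apply: ub_le_sup; last by exists t.
by exists b => _ [u Du <-]; exact: hb.
Qed.

Lemma sup_image_grid (c : R) :
  (forall t, D t -> exists k, h t <= h (tk k) + delta) ->
  c <= sup [set h t | t in D] -> exists k, c - delta <= h (tk k).
Proof.
move=> hk csup.
(* The best net point serves for all [t] at once, so the supremum need not be attained. *)
have [k kmax] : exists k, forall k', h (tk k') <= h (tk k).
  case: (arg_maxP (fun k => h (tk k)) (isT : xpredT ord0)) => k _ kmax.
  by exists k => k'; exact: kmax.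
exists k; rewrite lerBlDr; apply: le_trans csup _.
apply: ge_sup; first by exists (h (tk k)), (tk k).
move=> _ [t Dt <-]; have [k' /le_trans] := hk t Dt; apply.
by rewrite lerD2r.
Qed.

End sup_grid.

Section linear_process_theory.
Context {R : realType} {n : nat} {d : 'I_n -> measure_display}
  {S : forall i, measurableType (d i)}.
Context (T : R) (m : nat) (g : 'I_m -> product_space S -> R)
  (psi : 'I_m -> R -> R).
Hypotheses (mg : forall j, measurable_fun setT (g j))
  (g_bound : forall j z, -1 <= g j z <= 1).
Let X := linear_process g psi.

Let g_norm j z : `|g j z| <= 1.
Proof. by rewrite ler_norml. Qed.

Lemma measurable_linear_process t : measurable_fun setT (fun z => X z t).
Proof.
by apply: measurable_sum => j; exact: measurable_funM.
Qed.

Lemma linear_process_lipschitz z s t :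
  `|X z t - X z s| <= \sum_(j < m) `|psi j t - psi j s|.
Proof.
rewrite /X /linear_process -sumrB (le_trans (ler_norm_sum _ _ _))//.
by apply: ler_sum => j _; rewrite -mulrBr normrM ler_piMl.
Qed.

Hypothesis psi_sum :
  forall t : R, t \in `[0, T] -> \sum_(j < m) `|psi j t| = 1.

Lemma linear_process_bounded z t : t \in `[0, T] -> `|X z t| <= 1.
Proof.
move=> tT; rewrite -(psi_sum tT) (le_trans (ler_norm_sum _ _ _))//.
by apply: ler_sum => j _; rewrite normrM ler_piMl.
Qed.

(** The point [z0] puts 0 into the set, whose supremum would be [-oo] if it were empty; [|X| <= 1]
    bounds it by 2. *)
Lemma influence_fin_num (z0 : product_space S) i : 0 < T ->
  exists2 c, 0 <= c & influence T X i = c%:E.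
Proof.
move=> T0.
have I0 : (0 <= influence T X i)%E.
  apply: ereal_sup_ubound; exists 0, (z0 i), z0.
  by rewrite in_itv/= lexx ltW// replace_coord_id subrr normr0.
have I2 : (influence T X i <= 2%:E)%E.
  apply: ge_ereal_sup => _ [t [y [z [tT ->]]]].
  rewrite lee_fin (le_trans (ler_normB _ _))//.
  have -> : (2 : R) = 1 + 1 by ring.
  by rewrite lerD// linear_process_bounded.
exists (fine (influence T X i)); first by rewrite fine_ge0.
by rewrite fineK// ge0_fin_numE// (le_lt_trans I2)// ltry.
Qed.

Lemma influence_le t i (y : S i) z (c : R) : t \in `[0, T] ->
  influence T X i = c%:E -> X (replace_coord z y) t - X z t <= c.
Proof.
move=> tT Ic; apply: (le_trans (ler_norm _)).
by rewrite -lee_fin -Ic; apply: ereal_sup_ubound; exists t, y, z.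
Qed.

End linear_process_theory.

(** * Union bound over nets and measurability of the event *)

Unset Implicit Arguments.
Set Strict Implicit.

Theorem corollary7p2 (R : realType)
    (d0 : measure_display) (Omega : measurableType d0) (P : probability Omega R)
    (n : nat) (d : 'I_n -> measure_display)
    (S : forall i : 'I_n, measurableType (d i))
    (Z : Omega -> product_space S)
    (mZ : measurable_fun [set: Omega] Z)
    (indepZ : independent_components P Z)
    (T : R) (T_gt0 : 0 < T)
    (m : nat) (g : 'I_m -> product_space S -> R) (psi : 'I_m -> R -> R)
    (mg : forall j, measurable_fun [set: product_space S] (g j))
    (g_bound : forall j z, -1 <= g j z <= 1)
    (psi_C1 : forall j, C1_on `[0, T] (psi j))
    (psi_sum : forall t : R, t \in `[0, T] -> \sum_(j < m) `|psi j t| = 1)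
    (X_centered : forall t : R, t \in `[0, T] ->
       ('E_P[fun w => linear_process g psi (Z w) t] = 0)%E)
    (eta_gt1 : (1 < effective_sample_size T (linear_process g psi))%E)
    (eta_fin : (effective_sample_size T (linear_process g psi) < +oo)%E)
    (eps : R) (eps_gt0 : 0 < eps) :
  let X := linear_process g psi in
  let eta := fine (effective_sample_size T X) in
  (P [set w | (eps <=
        Num.sqrt eta / calR ((2 + arc_l1 T psi) ^+ 2 * eta)
        * sup [set `|X (Z w) t| | t in `[0, T]])%R]
   <= (2 * expR (- 2 * eps ^+ 2))%:E)%E.

Proof.
cbv zeta; set X := linear_process g psi.
set eta := fine (effective_sample_size T X).
have [w0 _] := probability_nonempty P.
have c_ex i : exists k, 0 <= k /\ influence T X i = k%:E.
  have [k k0 kE] := influence_fin_num g_bound psi_sum (Z w0) i T_gt0.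
  by exists k.
have [c cP] := choice c_ex.
pose V := \sum_i c i ^+ 2.
have V0 : 0 <= V by apply: sumr_ge0 => i _; exact: sqr_ge0.
have essE : effective_sample_size T X = ((V%:E)^-1)%E.
  rewrite /effective_sample_size /V -sumEFin; congr (_^-1)%E.
  by apply: eq_bigr => i _; rewrite (cP i).2.
(* With [0^-1 = +oo], finiteness of the effective sample size excludes [V = 0]. *)
have Vn0 : V != 0.
  by apply/eqP => V00; move: eta_fin; rewrite -/X essE V00 inve0 ltxx.
have {V0}Vgt0 : 0 < V by rewrite lt0r Vn0.
have etaE : eta = V^-1 by rewrite /eta essE inver (negbTE Vn0).
have eta1 : 1 < eta.
  by move: eta_gt1; rewrite -/X essE inver (negbTE Vn0) etaE lte_fin.
have eta0 : 0 < eta by lra.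
set a := arc_l1 T psi.
have a0 : 0 <= a := arc_ge0 T psi.
have X_norm z t := @linear_process_bounded R n d S T m g psi g_bound psi_sum z t.
have mX := @measurable_linear_process R n d S m g psi mg.
have mXZ (t : R) : measurable_fun setT (fun w => X (Z w) t).
  exact: (measurableT_comp (mX t) mZ).
set Rx := calR _.
have Rx0 : 0 < Rx.
  apply: calR_gt0; have : 1 < (2 + a) ^+ 2 by nra.
  nra.
have q0 : 0 < Num.sqrt eta by rewrite sqrtr_gt0.
pose c0 := eps * Rx / Num.sqrt eta.
pose M w := sup [set `|X (Z w) t| | t in `[0, T]].
have -> : [set w | eps <= Num.sqrt eta / Rx * M w] = [set w | c0 <= M w].
  apply/seteqP; split => w /=.
    rewrite /c0 ler_pdivrMr// => h.
    rewrite -ler_pdivlMr//; apply: le_trans h _.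
    by rewrite le_eqVlt; apply/orP; left; apply/eqP; ring.
  rewrite /c0 ler_pdivrMr// -ler_pdivlMr// => h.
  apply: le_trans h _.
  by rewrite le_eqVlt; apply/orP; left; apply/eqP; ring.
pose A (u t : R) : set Omega := [set w | u <= `|X (Z w) t|].
have mA (u t : R) : measurable (A u t).
  have -> : A u t = (fun w => `|X (Z w) t|) @^-1` `[u, +oo[.
    by apply/seteqP; split => w /=; rewrite /A/= in_itv/= andbT.
  have mh : measurable_fun setT (fun w => `|X (Z w) t|).
    by apply: measurableT_comp => //; exact: mXZ.
  by rewrite -[X in measurable X]setTI; exact: mh.
have mcd (u t : R) : t \in `[0, T] -> 0 < u ->
    (P (A u t) <= (2 * expR (- 2 * u ^+ 2 * eta))%:E)%E.
  move=> tT u0; rewrite etaE.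
  apply: (mcdiarmid_centered mZ indepZ (mX t) (M := 1)) => //.
  - by move=> z; exact: X_norm.
  - by move=> i; exact: (cP i).1.
  - by move=> z i y; exact: (influence_le y z tT (cP i).2).
  - by have := X_centered t tT; rewrite unlock /Rintegral => ->.
(* [E] says that some net point reaches the level lowered by the net error. The two inclusions yield
   measurability of the event as the net is refined; the first one and the union bound yield the
   estimate. *)
have grid N : exists E : set Omega, [/\ measurable E,
    [set w | c0 <= M w] `<=` E,
    E `<=` [set w | c0 - a / (2 * N.+1%:R) <= M w] &
    0 < c0 - a / (2 * N.+1%:R) ->
    (P E <= (N.+1%:R *
      (2 * expR (- 2 * (c0 - a / (2 * N.+1%:R)) ^+ 2 * eta)))%:E)%E].
  have [//|tk [tkT tkP]] := @arc_grid R T m psi T_gt0 psi_C1 N.+1.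
  set de := a / _; pose Ak k := A (c0 - de) (tk (inord k)).
  pose E := \big[setU/set0]_(i < N.+1) Ak i.
  exists E; split.
  - by apply: bigsetU_measurable => i _; exact: mA.
  - move=> w /= cM.
    have [||k kP] := @sup_image_grid R (fun t => `|X (Z w) t|) [set` `[0, T]]
      de N tk _ c0 _ cM.
    + by [].
    + move=> t tT; have [k kP] := tkP t tT; exists k.
      rewrite -lerBlDl (le_trans (lerB_dist _ _))// (le_trans _ kP)//.
      exact: linear_process_lipschitz.
    + rewrite /E -bigcup_mkord; exists k; first exact: ltn_ord.
      by rewrite /Ak /A /= inord_val.
  - rewrite /E -bigcup_mkord => w [i _]; rewrite /Ak /A/= => /le_trans; apply.
    have hb t : [set` `[0, T]] t -> `|X (Z w) t| <= 1 by exact: X_norm.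
    exact: (le_sup_image hb (tkT _)).
  - move=> u0; have sub := @Boole_inequality _ _ _ P Ak N.+1.
    apply: (le_trans (sub _)); first by move=> i _; exact: mA.
    apply: (@le_trans _ _
      (\sum_(i < N.+1) (2 * expR (- 2 * (c0 - de) ^+ 2 * eta))%:E)%E).
      by apply: lee_sum => i _; apply: mcd.
    by rewrite sumEFin sumr_const card_ord (mulr_natl _ N.+1).
have [E EP] := choice grid.
(* [P] is unconstrained on non-measurable sets, so even [P _ <= 1] needs the
   event to be measurable: it is the intersection of its net approximations. *)
have mM : measurable [set w | c0 <= M w].
  have -> : [set w | c0 <= M w] = \bigcap_N E N.
    apply/seteqP; split => w.
      by move=> cM N _; have [_ + _ _] := EP N; apply.
    move=> Ew; apply/ler_addgt0Pr => e e0.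
    have [|N N0 /andP[N1 _]] := @exists_nat_between R (a / e).
      by rewrite divr_ge0// ltW.
    have [_ _ /(_ w (Ew N I)) /= + _] := EP N.
    rewrite lerBlDr => /le_trans; apply; rewrite lerD2l.
    rewrite ler_pdivrMr ?mulr_gt0//.
    move: N1; rewrite ler_pdivrMr// => /le_trans; apply.
    rewrite mulrC ler_pM2l// -natr1.
    have : 0 <= N%:R :> R by []. lra.
  by apply: bigcapT_measurable => N; have [] := EP N.
(* In the first case the claimed bound exceeds 1. *)
have [small|large] := ltP (2 * eps ^+ 2) (ln 2).
  apply: (le_trans (probability_le1 P mM)); rewrite lee_fin.
  apply: (@le_trans _ _ (2 * expR (- ln 2))).
    by rewrite expRN lnK ?posrE// divff.
  by rewrite ler_pM2l// ler_expR; lra.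
have [N N0 HN] := exists_grid_size a0 eta1.
have [u0 uN] := grid_size_tail a0 eta1 eps_gt0 N0 large HN.
(* [E N] comes from a net of [N.+1] points, hence the shift. *)
case: N N0 HN u0 uN => [//|N] _ _; rewrite -/Rx -/c0 => u0 uN.
have [mE sub _ /(_ u0) PE] := EP N.
apply: le_trans (le_trans (le_measure P _ _ sub) PE) _; rewrite ?inE//.
by rewrite lee_fin mulrCA ler_pM2l.
Qed.
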